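(* Let $\mathbf{c}=(c_1,\dots,c_n)$ be a tuple of $n$ positive integers whose entries take $l$ distinct values, occurring with multiplicities $k_1,k_2,\dots,k_l$ respectively (so $k_1+\cdots+k_l=n$). Then the number of $\mathbf{c}$-labelled Dyck paths is $$(k_1!\,k_2!\cdots k_l!)\,C_n^{\mathbf{c}},$$ where $C_n^{\mathbf{c}}$ is the generalized Fuss--Catalan number associated with $\mathbf{c}$.
   Context: Let $C=\sum_{i=1}^n c_i$. The generalized Fuss--Catalan number associated with $\mathbf{c}$ is $$C_n^{\mathbf{c}}=\frac{n!}{k_1!\,k_2!\cdots k_l!}\cdot\frac{1}{C+1}\binom{C+n}{n}.$$ A $\mathbf{c}$-labelled Dyck path is a lattice path of $C+n$ steps from $(0,0)$ to $(C+n,0)$ that stays weakly above the $x$-axis and consists of $C$ down steps $D=(1,-1)$ and $n$ up steps, where for some permutation $\pi$ of $\{1,\dots,n\}$ the $i$-th up step (for $1\le i\le n$) is $U_{\pi(i)}=(1,c_{\pi(i)})$. The up steps carry their labels: $U_i$ and $U_j$ are regarded as different steps when $i\neq j$, even if $c_i=c_j$ (so a path is a sequence of symbols in $\{D,U_1,\dots,U_n\}$, each $U_i$ being used exactly once). *)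

(* Defs.v *)
From mathcomp Require Import all_boot all_order all_algebra all_fingroup.

Set Implicit Arguments.
Unset Strict Implicit.
Unset Printing Implicit Defensive.

Import Order.TTheory GRing.Theory Num.Theory.

Local Open Scope ring_scope.

Definition csum (n : nat) (c : n.-tuple nat) : nat :=
  (\sum_(i < n) tnth c i)%N.

(* Rational-valued: the last two factors alone, binom(C+n, n) / (C+1), need not
   be an integer, e.g. for n = 2 and C = 3. *)
Definition fuss_catalan (n : nat) (c : n.-tuple nat) : rat :=
  n`!%:R / (\prod_(v <- undup c) (count_mem v c)`!)%N%:R
  * ((csum c).+1%:R^-1 * 'C(csum c + n, n)%:R).

(* A symbol of {D, U_1, ..., U_n} is an element of [option 'I_n]:
   [None] is D = (1, -1) and [Some i] is the labelled up step U_i = (1, c_i). *)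
Definition rise (n : nat) (c : n.-tuple nat) (s : option 'I_n) : int :=
  if s is Some i then (tnth c i)%:Z else - 1.

Definition height (n : nat) (c : n.-tuple nat) (p : seq (option 'I_n))
    (m : nat) : int :=
  \sum_(s <- take m p) rise c s.

(* [pmap id p] is the sequence of labels of the up steps of p, in order. *)
Definition labelled_dyck (n : nat) (c : n.-tuple nat)
    (p : (csum c + n).-tuple (option 'I_n)) : bool :=
  [&& count_mem None p == csum c,
      [exists pi : 'S_n, pmap id p == [seq pi i | i <- enum 'I_n]],
      [forall m : 'I_(csum c + n).+1, 0 <= height c p m]
    & height c p (csum c + n) == 0].

Arguments labelled_dyck [n] c p.

(* Main.v *)
(* Appending a final D turns the labelled Dyck paths into the words with C + 1
   letters D and one of each U_i all of whose proper prefixes have nonnegative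
   height. By the cycle lemma each of the (C + n + 1)! / (C + 1)! words with
   these letters has exactly one such rotation among its C + n + 1 rotations,
   so there are (C + n)! / (C + 1)! labelled Dyck paths. *)
Require Import Defs.
From mathcomp Require Import all_boot all_order all_algebra all_fingroup.
From mathcomp Require Import zify.

Import Order.TTheory GRing.Theory Num.Theory.
Local Open Scope ring_scope.

(** * Prefix sums under rotation and the cycle lemma *)

Definition prefix_sum (s : seq int) (m : nat) : int := \sum_(x <- take m s) x.

(** Only proper prefixes are tested, so the total may be -1. *)
Definition prefixes_ge0 (s : seq int) : bool :=
  [forall m : 'I_(size s), 0 <= prefix_sum s m].

Lemma prefix_sum_rot (s : seq int) (r m : nat) :
  (r <= size s)%N -> (m <= size s)%N ->
  prefix_sum (rot r s) m =
  if (r + m <= size s)%N then prefix_sum s (r + m) - prefix_sum s r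
  else prefix_sum s (size s) - prefix_sum s r + prefix_sum s (r + m - size s).
Proof.
move=> le_r le_m; rewrite /prefix_sum /rot take_cat size_drop take_size.
have dropE : \sum_(x <- drop r s) x = \sum_(x <- s) x - \sum_(x <- take r s) x.
  by rewrite -[in X in X - _](cat_take_drop r s) big_cat /= (addrC (\sum_(_ <- take _ _) _)) addrK.
case: (leqP (r + m) (size s)) => le_rm; last first.
  have -> : (m < size s - r)%N = false by lia.
  rewrite big_cat /= dropE take_takel; last by lia.
  by congr (_ + \sum_(x <- take _ _) x); lia.
rewrite takeD big_cat /= [X in _ = X - _]addrC addrK.
case: ltnP => // le_m'.
have -> : m = (size s - r)%N by lia.
by rewrite subnn take0 cats0 -size_drop take_size.
Qed.

(* The condition says that r is the first position where the prefix sums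
   attain their minimum. *)
Lemma prefixes_ge0_rot (s : seq int) (r : nat) :
  \sum_(x <- s) x = -1 -> (r < size s)%N ->
  reflect ((forall j, (j < size s)%N -> prefix_sum s r <= prefix_sum s j) /\
           (forall j, (j < r)%N -> prefix_sum s r < prefix_sum s j))
          (prefixes_ge0 (rot r s)).
Proof.
move=> sum_s lt_r; have sumE : prefix_sum s (size s) = -1.
  by rewrite /prefix_sum take_size.
apply: (iffP forallP) => [ge0 | [ge_r gt_r] [m /=]].
  have ge0' m : (m < size s)%N -> 0 <= prefix_sum (rot r s) m.
    by rewrite -{1}(size_rot r s) => lt_m; apply: (ge0 (Ordinal lt_m)).
  have gt_r j : (j < r)%N -> prefix_sum s r < prefix_sum s j.
    (* This prefix of the rotation wraps around and stops at position [j] of [s]. Its sum is -1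
       minus the sum at [r] plus the sum at [j]; the -1 makes the inequality strict. For [j = 0]
       nothing wraps yet, hence the separate case. *)
    move=> lt_j; have lt_m : (size s - r + j < size s)%N by lia.
    have := ge0' _ lt_m; rewrite prefix_sum_rot ?sumE; try lia.
    case: leqP => [le_j | _].
      have -> : j = 0%N by lia.
      have -> : (r + (size s - r + 0))%N = size s by lia.
      by rewrite sumE /(prefix_sum s 0) take0 big_nil; lia.
    have -> : (r + (size s - r + j) - size s)%N = j by lia.
    by lia.
  split=> // j lt_j; case: (ltnP j r) => [/gt_r/ltW //|le_rj].
  have lt_m : (j - r < size s)%N by lia.
  have := ge0' _ lt_m; rewrite prefix_sum_rot; try lia.
  by rewrite subnKC // ltnW // subr_ge0.
rewrite size_rot => lt_m; rewrite prefix_sum_rot; try lia.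
case: leqP => le_rm.
  case: (ltnP (r + m) (size s)) => [/ge_r | ge_rm]; first by lia.
  (* The full length lies outside the range of [ge_r]. Here [r > 0], so strictness at position 0
     bounds the sum at [r] by -1, the total. *)
  have -> : (r + m)%N = size s by lia.
  rewrite sumE; have := gt_r 0%N.
  by rewrite /(prefix_sum s 0) take0 big_nil; lia.
by have := gt_r (r + m - size s)%N; rewrite sumE; lia.
Qed.

(** Both shifts are the first minimum of the prefix sums. *)
Lemma cycle_lemma_unique (s : seq int) (r1 r2 : nat) :
  \sum_(x <- s) x = -1 -> (r1 < size s)%N -> (r2 < size s)%N ->
  prefixes_ge0 (rot r1 s) -> prefixes_ge0 (rot r2 s) -> r1 = r2.
Proof.
move=> sum_s lt1 lt2.
move=> /(prefixes_ge0_rot _ _ sum_s lt1)[ge1 gt1].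
move=> /(prefixes_ge0_rot _ _ sum_s lt2)[ge2 gt2].
have := ge1 _ lt2; have := ge2 _ lt1.
by case: (ltngtP r1 r2) => // [/gt2|/gt1]; lia.
Qed.

Lemma cycle_lemma_exists (s : seq int) :
  \sum_(x <- s) x = -1 ->
  exists2 r, (r < size s)%N & prefixes_ge0 (rot r s).
Proof.
move=> sum_s; have s_gt0 : (0 < size s)%N.
  by case: s sum_s => //; rewrite big_nil.
pose minimal r :=
  (r < size s)%N && [forall j : 'I_(size s), prefix_sum s r <= prefix_sum s j].
have exm : exists r, minimal r.
  case: (arg_minP
    (fun i : 'I_(size s) => prefix_sum s i) (P := xpredT) (i0 := Ordinal s_gt0))
    => // r _ min_r.
  by exists r; rewrite /minimal ltn_ord; apply/forallP => j; apply: min_r.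
case: (ex_minnP exm) => r /andP[lt_r /forallP min_r] first_r.
exists r => //; apply/prefixes_ge0_rot => //; split=> j lt_j.
  exact: (min_r (Ordinal lt_j)).
have := min_r (Ordinal (ltn_trans lt_j lt_r)); rewrite /= le_eqVlt.
(* A tie at [j < r] would make [j] an earlier minimum. *)
case/orP=> // /eqP eq_j; suff /first_r: minimal j by lia.
rewrite /minimal (ltn_trans lt_j lt_r); apply/forallP => i.
by rewrite -eq_j; apply: min_r.
Qed.

(** * Words using each label exactly once *)

Definition labels_once (n : nat) (w : seq (option 'I_n)) : bool :=
  perm_eq (pmap id w) (enum 'I_n).

Lemma labels_onceP (n : nat) (w : seq (option 'I_n)) :
  reflect (exists pi : 'S_n, pmap id w = [seq pi i | i <- enum 'I_n])
          (labels_once n w).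
Proof.
have enumE (pi : 'S_n) :
    [seq pi i | i <- enum 'I_n] = [tuple tnth (ord_tuple n) (pi i) | i < n].
  by apply: eq_map => i; rewrite tnth_ord_tuple.
rewrite /labels_once -(val_ord_tuple n).
by apply: (iffP tuple_permP) => -[pi ->]; exists pi.
Qed.

Lemma count_mem_pmap_id (T : eqType) (x : T) (w : seq (option T)) :
  count_mem x (pmap id w) = count_mem (Some x) w.
Proof. by elim: w => [|[y|] w IHw] //=; rewrite IHw. Qed.

Lemma labels_once_count (n : nat) (w : seq (option 'I_n)) :
  labels_once n w = [forall i, count_mem (Some i) w == 1%N].
Proof.
apply/idP/forallP => [once i | once].
  rewrite -count_mem_pmap_id (seq.permP once) count_uniq_mem ?enum_uniq //.
  by rewrite mem_enum.
apply/allP => i _ /=; rewrite count_mem_pmap_id (eqP (once i)).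
by rewrite count_uniq_mem ?enum_uniq // mem_enum.
Qed.

Lemma count_None (n : nat) (w : seq (option 'I_n)) :
  labels_once n w -> (count_mem None w + n)%N = size w.
Proof.
move/perm_size; rewrite size_enum_ord => sz; rewrite -[X in (_ + X)%N]sz {sz}.
by elim: w => [|[y|] w IHw] //=; rewrite -IHw ?addnS ?addSn //.
Qed.

Lemma sum_rise (n : nat) (c : n.-tuple nat) (w : seq (option 'I_n)) :
  labels_once n w ->
  \sum_(s <- w) rise c s = (csum c)%:Z - (count_mem None w)%:Z.
Proof.
move=> once; rewrite /csum -(big_enum_cond _ _ xpredT) /=.
(* With [csum c] replaced by the sum over the labels occurring in [w], the identity holds for every
   word, so induction applies. *)
rewrite -(perm_big _ once) /=; move: {once} w.
elim=> [|[i|] w IHw]; rewrite ?big_nil // big_cons IHw /= ?big_cons; lia.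
Qed.

(** Such a word amounts to an injection from labels to positions, the positions left over carrying
    D. *)
Lemma card_labels_once (n m : nat) :
  #|[set w : m.-tuple (option 'I_n) | labels_once n w]| = (m ^_ n)%N.
Proof.
have -> : (m ^_ n = #|[set f : {ffun 'I_n -> 'I_m} | injectiveb f]|)%N.
  by rewrite card_inj_ffuns !card_ord.
pose word (f : {ffun 'I_n -> 'I_m}) := [tuple [pick i | f i == j] | j < m].
have wordE (f : {ffun 'I_n -> 'I_m}) i j :
    injective f -> (tnth (word f) j == Some i) = (f i == j).
  move=> inj_f; rewrite tnth_mktuple; case: pickP => [k /eqP <-|none].
    by rewrite (inj_eq inj_f) eq_sym; apply/eqP/eqP => [[]|->].
  by rewrite none.
have countE (w : m.-tuple (option 'I_n)) x :
    count_mem x w = #|[pred j | tnth w j == x]|.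
  rewrite -{1}(map_tnth_enum w) count_map cardE size_filter.
  by rewrite enumT; apply: eq_count => j.
have <- : word @: [set f : {ffun 'I_n -> 'I_m} | injectiveb f] =
          [set w : m.-tuple (option 'I_n) | labels_once n w].
  apply/setP => w; rewrite inE labels_once_count; apply/imsetP/forallP.
    move=> [f]; rewrite inE => /injectiveP inj_f -> i.
    rewrite countE; apply/eqP; rewrite -(card1 (f i)); apply: eq_card => j.
    by rewrite !inE wordE // eq_sym.
  move=> once.
  (* The inverse construction: the unique position of each label. *)
  have pos i : {j | tnth w j = Some i & forall k, tnth w k = Some i -> k = j}.
    have := once i; rewrite countE => /eqP/mem_card1 [j jE].
    exists j => [|k /eqP wk]; first by apply/eqP; have := jE j; rewrite !inE eqxx.
    by apply/eqP; have := jE k; rewrite !inE wk.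
  pose f := [ffun i => s2val (pos i)].
  have fP i : tnth w (f i) = Some i by rewrite ffunE; case: (pos i).
  have inj_f : injective f by move=> i1 i2 e; apply: Some_inj; rewrite -!fP e.
  exists f; first by rewrite inE; apply/injectiveP.
  apply: eq_from_tnth => j; case Ew: (tnth w j) => [i|].
    apply/esym/eqP; rewrite wordE //; apply/eqP; rewrite ffunE.
    by case: (pos i) => k _ /= /(_ _ Ew) ->.
  rewrite tnth_mktuple; case: pickP => // i /eqP fi.
  by rewrite -Ew -fi fP.
rewrite card_in_imset // => f g; rewrite !inE.
move=> /injectiveP inj_f /injectiveP inj_g eq_fg; apply/ffunP => i.
by apply/esym/eqP; rewrite -wordE // -eq_fg wordE.
Qed.

(** * Counting the cyclic representatives *)

(** The length and [labels_once] force C + 1 letters D, hence total rise -1. *)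
Definition cyclic_representatives (n : nat) (c : n.-tuple nat) :
    {set (csum c + n).+1.-tuple (option 'I_n)} :=
  [set w : (csum c + n).+1.-tuple (option 'I_n) |
    labels_once n w && prefixes_ge0 (map (rise c) w)].

Lemma labels_once_rot (n r : nat) (w : seq (option 'I_n)) :
  labels_once n (rot r w) = labels_once n w.
Proof.
rewrite !labels_once_count; apply: eq_forallb => i.
by have /seq.permP -> : perm_eq (rot r w) w by rewrite perm_rot.
Qed.

(** Pairs of a representative and a shift biject with all words: existence in the cycle lemma gives
    surjectivity, uniqueness gives injectivity. *)
Lemma card_cyclic_representatives (n : nat) (c : n.-tuple nat) :
  (#|cyclic_representatives n c| * (csum c + n).+1 =
   (csum c + n).+1 ^_ n)%N.
Proof.
rewrite -card_labels_once.
set A := [set w : (csum c + n).+1.-tuple _ | _].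
have sumA (w : (csum c + n).+1.-tuple (option 'I_n)) :
    w \in A -> \sum_(x <- map (rise c) w) x = -1.
  rewrite inE => once; rewrite big_map sum_rise //.
  by have := count_None _ _ once; rewrite size_tuple; lia.
pose unrotate (x : (csum c + n).+1.-tuple (option 'I_n) * 'I_(csum c + n).+1) :=
  [tuple of rotr x.2 x.1].
have <- : unrotate @: setX (cyclic_representatives n c) setT = A.
  apply/setP => w; apply/imsetP/idP => [[[b r]]|wA].
    by rewrite !inE andbT => /andP[once _] ->; rewrite /= /rotr labels_once_rot.
  have [r] := cycle_lemma_exists _ (sumA w wA).
  rewrite size_map size_tuple => lt_r ge0.
  exists ([tuple of rot r w], Ordinal lt_r); last first.
    by apply: val_inj; rewrite /= rotK.
  by rewrite !inE /= labels_once_rot map_rot ge0 !andbT; move: wA; rewrite inE.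
suff /card_in_imset -> :
    {in setX (cyclic_representatives n c) setT &, injective unrotate}.
  by rewrite cardsX cardsT card_ord.
move=> [b1 r1] [b2 r2]; rewrite !inE !andbT /=.
move=> /andP[once1 ge1] /andP[once2 ge2] eq_rot.
have eqw : rotr r1 b1 = rotr r2 b2 by have := congr1 val eq_rot.
have uA : unrotate (b1, r1) \in A by rewrite inE /= /rotr labels_once_rot.
(* Rotating the common word by [r1] or by [r2] yields a representative. *)
have eq_r : r1 = r2.
  apply: val_inj => /=.
  apply: (cycle_lemma_unique _ _ _ (sumA _ uA)); rewrite ?size_map ?size_tuple //.
    by rewrite -map_rot /= rotrK.
  by rewrite -map_rot /= eqw rotrK.
congr (_, _) => //; apply: val_inj => /=.
by have := congr1 (rot r2) eqw; rewrite eq_r !rotrK.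
Qed.

(** * Labelled Dyck paths as representatives *)

Lemma height_map (n : nat) (c : n.-tuple nat) (p : seq (option 'I_n)) m :
  height c p m = prefix_sum (map (rise c) p) m.
Proof. by rewrite /prefix_sum -map_take big_map. Qed.

(** Once the labels are right, the length forces C letters D and final height 0. Only the heights
    remain, and the proper prefixes of [rcons p None] are exactly the prefixes of [p]. *)
Lemma labelled_dyck_rcons (n : nat) (c : n.-tuple nat)
    (p : (csum c + n).-tuple (option 'I_n)) :
  labelled_dyck c p = ([tuple of rcons p None] \in cyclic_representatives n c).
Proof.
rewrite inE /= /labelled_dyck.
have -> : [exists pi : 'S_n, pmap id p == [seq pi i | i <- enum 'I_n]]
          = labels_once n p.
  by apply/existsP/labels_onceP => -[pi /eqP e]; exists pi => //; apply/eqP.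
have -> : labels_once n (rcons p None) = labels_once n p.
  by rewrite /labels_once -cats1 pmap_cat cats0.
have [once|_] := boolP (labels_once n p); last by rewrite !andbF.
have cntE : count_mem None p = csum c.
  by have := count_None _ _ once; rewrite size_tuple; lia.
have totE : height c p (csum c + n) == 0.
  rewrite /height -{1}(size_tuple p) take_size sum_rise // cntE; lia.
rewrite cntE eqxx totE andbT /=.
have prefE (m : nat) : (m < (csum c + n).+1)%N ->
    prefix_sum (map (rise c) (rcons p None)) m = height c p m.
  move=> lt_m; rewrite height_map /prefix_sum -cats1 map_cat takel_cat //.
  by rewrite size_map size_tuple.
have szE : size (map (rise c) (rcons p None)) = (csum c + n).+1.
  by rewrite size_map size_rcons size_tuple.
rewrite /prefixes_ge0 szE.
by apply: eq_forallb => m; rewrite prefE.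
Qed.

(** The total rise is -1, which an up step cannot reach from a nonnegative height. *)
Lemma last_step_None (n : nat) (c : n.-tuple nat) (s : seq (option 'I_n))
    (y : option 'I_n) :
  labels_once n (rcons s y) -> size s = (csum c + n)%N ->
  0 <= \sum_(x <- s) rise c x -> y = None.
Proof.
move=> once size_s; have := sum_rise _ c _ once; have := count_None _ _ once.
rewrite size_rcons size_s -cats1 big_cat big_seq1.
set S := \sum_(x <- s) _.
by case: y {once} => //= i; set N := count _ _; move=> *; exfalso; lia.
Qed.

Lemma card_labelled_dyck (n : nat) (c : n.-tuple nat) :
  #|[set p : (csum c + n).-tuple (option 'I_n) | labelled_dyck c p]| =
  #|cyclic_representatives n c|.
Proof.
pose snoc (p : (csum c + n).-tuple (option 'I_n)) := [tuple of rcons p None].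
have <- : snoc @: [set p | labelled_dyck c p] = cyclic_representatives n c.
  apply/setP => w; apply/imsetP/idP => [[p]|wB].
    by rewrite inE labelled_dyck_rcons => ? ->.
  case/lastP Ew: (tval w) => [|s y]; first by have := size_tuple w; rewrite Ew.
  have szs : size s == (csum c + n)%N.
    by have := congr1 size Ew; rewrite size_rcons size_tuple => -[->].
  have wE : w = [tuple of rcons (Tuple szs) y].
    by apply: val_inj.
  have yE : y = None.
    move: wB; rewrite wE inE /= => /andP[once /forallP ge0].
    apply: (last_step_None _ c s y once (eqP szs)).
    (* The longest proper prefix, [s] itself, has nonnegative height. *)
    have lt_s : (size s < size (map (rise c) (rcons s y)))%N.
      by rewrite size_map size_rcons.
    have := ge0 (Ordinal lt_s); rewrite /= /prefix_sum -map_take -cats1.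
    by rewrite take_size_cat // big_map.
  exists (Tuple szs); last by rewrite wE yE.
  by rewrite inE labelled_dyck_rcons; rewrite wE yE in wB.
rewrite card_imset // => p q /(congr1 val) /= /rcons_inj [] ?.
exact: val_inj.
Qed.

(** * The closed formula *)

Theorem theorem12 (n l : nat) (c : n.-tuple nat) (v k : l.-tuple nat)
    (c_pos : forall i : 'I_n, (0 < tnth c i)%N)
    (v_uniq : uniq v)
    (v_values : v =i c)
    (k_mult : forall j : 'I_l, tnth k j = count_mem (tnth v j) c) :
  #|[set p : (csum c + n).-tuple (option 'I_n) | labelled_dyck c p]|%:R
  = (\prod_(j < l) (tnth k j)`!)%N%:R * fuss_catalan c.
Proof.
(* Both products run over the distinct values of [c], since [v] is a permutation of [undup c]. *)
have -> : (\prod_(j < l) (tnth k j)`! =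
           \prod_(x <- undup c) (count_mem x c)`!)%N.
  have eq_v : perm_eq v (undup c).
    by rewrite uniq_perm ?undup_uniq // => x; rewrite mem_undup.
  by rewrite -(perm_big _ eq_v) big_tuple; apply: eq_bigr => j _; rewrite k_mult.
rewrite /fuss_catalan card_labelled_dyck; set N := #|_|.
set P := (\prod_(x <- _) _)%N; set C := csum c.
have count : (N * C.+1 = 'C(C + n, n) * n`!)%N.
  (* After multiplication by C + n + 1, both sides equal the falling factorial [(C + n).+1 ^_ n.+1],
     whose last factor is C + 1. *)
  apply/eqP; rewrite bin_ffact -(eqn_pmul2l (ltn0Sn (C + n))) -ffactSS.
  rewrite mulnA (mulnC _ N) card_cyclic_representatives ffactnSr.
  by rewrite -addSn addnK.
have P_neq0 : P%:R != 0 :> rat.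
  by rewrite pnatr_eq0 -lt0n prodn_gt0 // => x; apply: fact_gt0.
have C_neq0 : C.+1%:R != 0 :> rat by rewrite pnatr_eq0.
(* The product [P] cancels the denominator in [fuss_catalan]. *)
rewrite [RHS]mulrA [P%:R * _]mulrC divfK //.
apply: (mulIf C_neq0); rewrite -natrM count natrM.
by rewrite -mulrA [_^-1 * _]mulrC divfK // mulrC.
Qed.
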